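(* Let $n\in\{1,2,3\}$ and let $\alpha = \mathrm{Re}(dz^1\wedge\cdots\wedge dz^n)$ be the special Lagrangian calibration on $\mathbb{R}^{2n}=\mathbb{C}^n$. If $\psi\colon\mathbb{R}^{2n}\to\mathbb{R}^{2n}$ is an affine map preserving $\alpha$ for which $\psi(B(r))\subseteq Z_L(R)$ for some $\alpha$-calibrated subspace $L$, then $r\leq R$.
   Context: $\mathbb{C}^n=\mathbb{R}^{2n}$ has coordinates $z^k=x^k+iy^k$ and the standard Euclidean metric. $\alpha$ is a real $n$-form on $\mathbb{R}^{2n}$ with $|\alpha(v_1,\dots,v_n)|\leq 1$ for all orthonormal $v_1,\dots,v_n$. An $n$-dimensional oriented real subspace $L$ is $\alpha$-calibrated if $\alpha(v_1,\dots,v_n)=1$ for some (equivalently every) oriented orthonormal basis of $L$. An affine map $\psi(x)=\Psi x+x_0$ with $\Psi\in\mathrm{GL}(2n,\mathbb{R})$ and $x_0\in\mathbb{R}^{2n}$ preserves $\alpha$ if $\Psi^*\alpha=\alpha$. $r,R>0$ are real numbers, $B(r)$ is the closed ball of radius $r$ centered at the origin in $\mathbb{R}^{2n}$, and $Z_L(R)=\{x\in\mathbb{R}^{2n} : |\mathrm{proj}_L(x)|^2\leq R^2\}$, where $\mathrm{proj}_L$ is the orthogonal projection onto $L$. *)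

(* Defs.v *)
From HB Require Import structures.
From mathcomp Require Import all_boot all_order all_algebra.
From mathcomp Require Import complex.
From mathcomp Require Import classical_sets reals.

Set Implicit Arguments.
Unset Strict Implicit.
Unset Printing Implicit Defensive.

Import Order.TTheory GRing.Theory Num.Theory.
Local Open Scope ring_scope.
Local Open Scope classical_set_scope.

Section Euclidean.
Variables (R : realType) (m : nat).
Implicit Types (u v x : 'cV[R]_m) (L : {vspace 'cV[R]_m}).

Definition dot u v : R := \sum_i u i 0 * v i 0.

Let dotDl (k : R) u u' v : dot (k *: u + u') v = k * dot u v + dot u' v.
Proof.
rewrite /dot mulr_sumr -big_split; apply: eq_bigr => i _ /=.
by rewrite !mxE mulrDl mulrA.
Qed.

Let dotC u v : dot u v = dot v u.
Proof. by apply: eq_bigr => i _; rewrite mulrC. Qed.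

Let dot_linearl v : GRing.linear_for *%R (dot^~ v).
Proof. by move=> k u u'; rewrite dotDl. Qed.

Let dot_linearr u : GRing.linear_for (idfun \; *%R) (dot u).
Proof. by move=> k v v'; rewrite dotC dotDl ![dot _ u]dotC. Qed.

HB.instance Definition _ :=
  @bilinear_isBilinear.Build R 'cV[R]_m 'cV[R]_m R *%R (idfun \; *%R) dot
    (dot_linearl, dot_linearr).

Let dot_hermitian u v : dot u v = (-1) ^+ false * idfun (dot v u).
Proof. by rewrite expr0 mul1r dotC. Qed.

HB.instance Definition _ :=
  @isHermitianSesquilinear.Build R 'cV[R]_m false idfun dot dot_hermitian.

Lemma dot_gt0 u : u != 0 -> 0 < dot u u.
Proof.
have ge0 i : 0 <= u i 0 * u i 0 by rewrite -expr2 sqr_ge0.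
move=> u0; rewrite lt_def sumr_ge0 ?andbT //.
apply: contraNneq u0 => d0; apply/eqP/colP => i; rewrite mxE.
move/eqP: d0; rewrite psumr_eq0 // => /allP/(_ i (mem_index_enum i)) /=.
by rewrite mulf_eq0 orbb => /eqP.
Qed.

HB.instance Definition _ := isDotProduct.Build R 'cV[R]_m dot dot_gt0.

(* The library's norm on matrices is the sup norm, hence this definition. *)
Definition enorm v : R := Num.sqrt (dot v v).

Definition eball (r : R) : set 'cV[R]_m := [set x | enorm x <= r].

Definition proj L : 'End('cV[R]_m) := daddv_pi L (orthov dot L).

(* [daddv_pi] is only meaningful for complementary subspaces. *)
Lemma cap_orthov L : (L :&: orthov dot L)%VS = 0%VS.
Proof.
apply/eqP; rewrite -subv0; apply/subvP => u; rewrite memv_cap memv0.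
case/andP => uL /mem_orthovP/(_ u uL) uu.
by apply: contraTT isT => /dot_gt0; rewrite uu ltxx.
Qed.

Lemma add_orthov L : (L + orthov dot L)%VS = fullv.
Proof.
pose g u : 'cV[R]_(\dim L) := \col_i dot u (vbasis L)`_i.
have g_lin : linear g.
  by move=> k u v; apply/colP => i; rewrite !mxE linearPl.
pose G := GRing.isLinear.Build _ _ _ _ g g_lin.
pose gl : {linear 'cV[R]_m -> 'cV[R]_(\dim L)} := HB.pack g G.
have kerE : (lker (linfun gl) <= orthov dot L)%VS.
  apply/subvP => u; rewrite memv_ker lfunE /= => /eqP/colP gu.
  apply/mem_orthovP => v /coord_vbasis ->.
  rewrite linear_sumr big1 // => i _; rewrite linearZr_LR /=.
  by have := gu i; rewrite !mxE => ->; rewrite mulr0.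
apply/eqP; rewrite eqEdim subvf /= dimv_disjoint_sum ?cap_orthov //.
rewrite -(limg_ker_dim (linfun gl) fullv) capfv addnC leq_add ?dimvS //.
by apply: leq_trans (dimvS (subvf _)) _; rewrite dimvf /dim /= muln1.
Qed.

Lemma proj_mem L x : proj L x \in L.
Proof. exact: memv_pi. Qed.

Lemma proj_orthov L x : x - proj L x \in orthov dot L.
Proof.
rewrite -{1}(daddv_pi_add (cap_orthov L) (w := x)) ?add_orthov ?memvf //.
by rewrite addrC addKr memv_pi.
Qed.

Definition cylinder L (r : R) : set 'cV[R]_m :=
  [set x | enorm (proj L x) ^+ 2 <= r ^+ 2].

Definition affine (Psi : 'M[R]_m) (x0 x : 'cV[R]_m) : 'cV[R]_m :=
  Psi *m x + x0.

End Euclidean.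

(* An orientation of an n-dimensional subspace is an equivalence class of      *)
(* ordered bases, two bases being equivalent when the change of basis between  *)
(* them has positive determinant.                                              *)
Record orientedSubspace (R : realType) (V : vectType R) (n : nat) :=
  OrientedSubspace {
    os_space :> {vspace V};
    oriented : pred (n.-tuple V);
    _ : exists b, oriented b;
    _ : forall b : n.-tuple V, oriented b -> basis_of os_space b;
    _ : forall b b' : n.-tuple V, oriented b -> basis_of os_space b' ->
          oriented b' = (0 < \det (\matrix_(i, j) coord b i (tnth b' j)))
  }.

Section Forms.
Variables (R : realType) (m n : nat).
Implicit Types (a : n.-tuple 'cV[R]_m -> R).

Definition pullback (Psi : 'M[R]_m) a : n.-tuple 'cV[R]_m -> R :=
  fun v => a (map_tuple (mulmx Psi) v).

Definition calibrated a (L : orientedSubspace 'cV[R]_m n) : Prop :=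
  exists v : n.-tuple 'cV[R]_m,
    [/\ oriented L v, orthonormal (@dot R m) v & a v = 1].

(* w_0 /\ ... /\ w_{n-1} for complex-valued 1-forms w_k, normalised so that    *)
(* its value on (v_0, ..., v_{n-1}) is det (w_k (v_j)).                        *)
Definition wedge (w : 'I_n -> 'cV[R]_m -> R[i]) (v : n.-tuple 'cV[R]_m) : R[i] :=
  \det (\matrix_(k, j) w k (tnth v j)).

End Forms.

Section SpecialLagrangian.
Variables (R : realType) (n : nat).

(* Coordinates on R^(n + n) are ordered as x^1, ..., x^n, y^1, ..., y^n. *)
Definition dz (k : 'I_n) (v : 'cV[R]_(n + n)) : R[i] :=
  Complex (v (lshift n k) 0) (v (rshift n k) 0).

Definition special_lagrangian (v : n.-tuple 'cV[R]_(n + n)) : R :=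
  complex.Re (wedge dz v).

End SpecialLagrangian.

(* Main.v *)
Require Import Defs.
From mathcomp Require Import all_boot all_order all_algebra.
From HB Require Import structures.
From mathcomp Require Import complex ring lra.
From mathcomp Require Import classical_sets reals.

Set Implicit Arguments.
Unset Strict Implicit.
Unset Printing Implicit Defensive.

Import Order.TTheory GRing.Theory Num.Theory.
Local Open Scope ring_scope.
Local Open Scope complex_scope.
Local Open Scope sesquilinear_scope.
Local Open Scope classical_set_scope.

(** Write Omega = dz^1 /\ ... /\ dz^n, so that the calibration is Re Omega, and
    let v be an oriented orthonormal basis of L on which it takes the value 1.

    The image of the ball is an ellipsoid whose projection to the line spanned
    by a unit vector u of L has half-width r |Psi^T u|.  Fitting it into the
    cylinder therefore forces r |Psi^T u| <= rho, wherever the ellipsoid is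
    centred ([affine_squeeze]).  It remains to find j with |Psi^T v_j| >= 1.
    By Hadamard's inequality ([hadamard], [exists_col_ge1]),
    |Omega (w_1, ..., w_n)| <= |w_1| ... |w_n|, so it is enough to know that
    |Omega (Psi^T v_1, ..., Psi^T v_n)| >= 1 ([norm_det_preserves_sl]).  In
    other words the hypothesis on Psi has to be transferred to its transpose.
    This is where the dimension matters.

    - n = 1: the calibration is the linear form dx, and v_1 is the first basis
      vector; Psi preserves dx exactly when Psi^T fixes that vector.
    - n = 2: the calibration is a symplectic form, with a Gram matrix G such
      that G^2 = -1; as for symplectic matrices, Psi^T G Psi = G implies
      Psi G Psi^T = G ([preserves_sl2_trmx]).
    - n = 3: Psi is complex linear or antilinear ([rsubmx_sl3]).  Indeed the
      kernel of the 2-form Re Omega (u, ., .) is the complex line of u, so Psi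
      maps complex lines to complex lines; and a real-linear bijection with this
      property in complex dimension at least 2 commutes or anticommutes with i.
      Its complex matrix M has Re (det M) = 1, and Psi^T acts on C^3 by the
      adjoint of M, or by conjugation followed by the transpose of M; it
      scales |Omega| by |det M| >= 1 ([norm_det_trmx]). *)

(** * Hadamard's inequality *)

(** Gram-Schmidt on the rows writes A = T U with U unitary and T lower
    triangular.  Then |det A| is the product of the |T i i|, and row i of T is
    as long as row i of A. *)
Lemma hadamard (C : numClosedFieldType) n (A : 'M[C]_n) :
  `|\det A| ^+ 2 <= \prod_i \sum_j `|A i j| ^+ 2.
Proof.
have [U Uu AU] : exists2 U : 'M[C]_n, U \is unitarymx &
    forall i, (row i A <= \sum_(k < n | (k <= i)%N) <<row k U>>)%MS.
  exists (schmidt A); first exact: schmidt_unitarymx.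
  by move=> i; apply: row_schmidt_sub.
have UU := unitarymxP Uu.
pose T := A *m U ^t*.
have T_trig : is_trig_mx T.
  apply/is_trig_mxP => i j ij.
  have /sub_sumsmxP[c Ai] := AU i.
  have -> : T i j = (row i A *m col j (U ^t*)) 0 0.
    by rewrite -row_mul !mxE; apply: eq_bigr => k _; rewrite !mxE.
  rewrite Ai mulmx_suml summxE big1 // => k ki.
  have /submxP[d ->] : (c k *m <<row k U>> <= row k U)%MS.
    by rewrite (submx_trans (submxMl _ _)) // genmxE.
  have Ukj : row k U *m col j (U ^t*) = 0.
    apply/rowP => l; rewrite (ord1 l).
    have /matrixP/(_ k j) := UU; rewrite !mxE => UUkj.
    transitivity ((k == j)%:R : C); last first.
      by rewrite -val_eqE ltn_eqF // (leq_ltn_trans ki).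
    by rewrite -[RHS]UUkj; apply: eq_bigr => m _; rewrite !mxE.
  by rewrite -mulmxA Ukj mulmx0 mxE.
have detT : `|\det T| = `|\det A|.
  have : `|\det U| * `|\det U| = 1.
    have := congr1 (fun X => \det X) UU.
    rewrite det_mulmx det1 det_map_mx det_tr => /(congr1 Num.norm).
    by rewrite normrM norm_conjC normr1.
  move=> dU; rewrite det_mulmx det_map_mx det_tr normrM norm_conjC.
  have /orP[/eqP->|/eqP dU1] : (`|\det U| == 1) || (`|\det U| == -1).
  - by rewrite -eqf_sqr expr1n expr2 dU.
  - by rewrite mulr1.
  - by have := normr_ge0 (\det U); rewrite dU1 oppr_ge0 ler10.
have TT i : \sum_j `|T i j| ^+ 2 = \sum_j `|A i j| ^+ 2.
  have rowE (B : 'M[C]_n) : (B *m B ^t*) i i = \sum_j `|B i j| ^+ 2.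
    by rewrite mxE; apply: eq_bigr => j _; rewrite !mxE normCK.
  have -> : \sum_j `|T i j| ^+ 2 = (T *m T ^t*) i i by rewrite rowE.
  rewrite -rowE /T; congr (fun_of_matrix _ i i).
  by rewrite trmx_mul map_mxM trmxCK mulmxA mulmxKtV.
rewrite -detT det_trig // normr_prod -prodrXl.
apply: ler_prod => i _; rewrite exprn_ge0 //= -TT.
by rewrite (bigD1 i) //= lerDl sumr_ge0 // => j _; rewrite exprn_ge0.
Qed.

(** * Real and complex coordinates *)

Definition cols (K : pzRingType) m n (v : n.-tuple 'cV[K]_m) : 'M[K]_(m, n) :=
  \matrix_(i, j) tnth v j i 0.

Lemma mulmx_cols (K : pzRingType) p m n (A : 'M[K]_(p, m))
    (v : n.-tuple 'cV[K]_m) :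
  A *m cols v = cols (map_tuple (mulmx A) v).
Proof.
apply/matrixP => i j; rewrite !mxE tnth_map !mxE.
by apply: eq_bigr => k _; rewrite !mxE.
Qed.

Section Realification.
Variables (R : realType) (n : nat).

(** The identification of R^(n + n) with C^n, applied to each column. *)
Definition cmx p (V : 'M[R]_(n + n, p)) : 'M[R[i]]_(n, p) :=
  \matrix_(k, j) (V (lshift n k) j +i* V (rshift n k) j).

Lemma cmxB p : zmod_morphism (@cmx p).
Proof. by move=> U V; apply/matrixP => i j; rewrite !mxE; simpc. Qed.

HB.instance Definition _ p :=
  GRing.isZmodMorphism.Build 'M[R]_(n + n, p) 'M[R[i]]_(n, p)
    (@cmx p) (@cmxB p).

Lemma cmx_cols p (v : p.-tuple 'cV[R]_(n + n)) :
  cmx (cols v) = cols (map_tuple (@cmx 1) v).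
Proof. by apply/matrixP => i j; rewrite !mxE tnth_map !mxE. Qed.

Lemma cmx_col_mx p (P Q : 'M[R]_(n, p)) :
  cmx (col_mx P Q) =
  map_mx (real_complex R) P + 'i *: map_mx (real_complex R) Q.
Proof. by apply/matrixP => i j; rewrite mxE col_mxEu col_mxEd !mxE; simpc. Qed.

Lemma cmx_mulr p q (V : 'M[R]_(n + n, p)) (B : 'M[R]_(p, q)) :
  cmx (V *m B) = cmx V *m map_mx (real_complex R) B.
Proof.
rewrite -[V]vsubmxK mul_col_mx !cmx_col_mx mulmxDl !map_mxM.
by rewrite scalemxAl.
Qed.

Lemma cmx_mull p (Psi : 'M[R]_(n + n)) (P Q : 'M[R]_(n, p)) :
  cmx (Psi *m col_mx P Q) =
  cmx (lsubmx Psi) *m map_mx (real_complex R) P +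
  cmx (rsubmx Psi) *m map_mx (real_complex R) Q.
Proof. by rewrite -{1}[Psi]hsubmxK mul_row_col raddfD /= !cmx_mulr. Qed.

Lemma special_lagrangianE (v : n.-tuple 'cV[R]_(n + n)) :
  special_lagrangian v = complex.Re (\det (cmx (cols v))).
Proof.
congr (complex.Re (\det _)); apply/matrixP => k j; rewrite !mxE.
by rewrite /dz.
Qed.

Lemma sum_normr_cmx p (V : 'M[R]_(n + n, p)) j :
  \sum_k `|cmx V k j| ^+ 2 = (dot (col j V) (col j V))%:C.
Proof.
rewrite /dot big_split_ord rmorphD !rmorph_sum -big_split /=.
by apply: eq_bigr => k _; rewrite -add_Re2_Im2 !mxE /= rmorphD !expr2.
Qed.

(** The image of x + iy under Psi is A x + B y for the complex matrices A and B
    obtained from the two halves of Psi.  The hypothesis B = l A with l = i or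
    l = -i says that Psi is complex linear or antilinear with matrix A.  Reading
    off real and imaginary parts, the transpose is then the complex linear map
    given by the adjoint of A, or the antilinear map given by the transpose. *)
Lemma norm_det_trmx (Psi : 'M[R]_(n + n)) (l : R[i]) (V : 'M[R]_(n + n, n)) :
    l ^+ 2 = -1 -> cmx (rsubmx Psi) = l *: cmx (lsubmx Psi) ->
  `|\det (cmx (Psi^T *m V))| = `|\det (cmx (lsubmx Psi))| * `|\det (cmx V)|.
Proof.
set M := cmx (lsubmx Psi) => l2 NM.
have NMij i j : cmx (rsubmx Psi) i j = l * M i j by rewrite NM mxE.
have dT : (\det M^T) = \det M by rewrite det_tr.
have /orP[] : (l == 'i) || (l == - 'i).
- by rewrite -eqf_sqr l2 sqr_i.
- move/eqP => li; have -> : cmx (Psi^T *m V) = M ^t* *m cmx V.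
    rewrite -[V]vsubmxK cmx_mull cmx_col_mx mulmxDr -scalemxAr scalemxAl.
    congr (_ + _); congr (_ *m _); apply/matrixP => i j.
    + by have := NMij j i; rewrite li !mxE; simpc => -[-> _].
    + by have := NMij j i; rewrite li !mxE; simpc => -[_ ->].
  by rewrite det_mulmx det_map_mx normrM norm_conjC dT.
- move/eqP => li.
  have -> : cmx (Psi^T *m V) = M ^T *m map_mx (@conjc R) (cmx V).
    rewrite -[V]vsubmxK cmx_mull cmx_col_mx map_mxD mulmxDr map_mxZ /=.
    have conjR p (B : 'M[R]_(n, p)) :
        map_mx (@conjc R) (map_mx (real_complex R) B) =
        map_mx (real_complex R) B.
      by apply/matrixP => i j; rewrite !mxE; simpc.
    rewrite -scalemxAr scalemxAl !conjR.
    congr (_ + _); congr (_ *m _); apply/matrixP => i j.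
    + by have := NMij j i; rewrite li !mxE; simpc => -[-> _].
    + by have := NMij j i; rewrite li !mxE; simpc => -[_ ->].
  by rewrite det_mulmx det_map_mx normrM normcJ dT.
Qed.

End Realification.

Lemma det_cols2 (K : comPzRingType) (p q : 'cV[K]_2) :
  \det (cols [tuple p; q]) = p 0 0 * q 1 0 - q 0 0 * p 1 0.
Proof.
rewrite (expand_det_row _ 0) !big_ord_recl big_ord0 /cofactor !det_mx11 !mxE /=.
have -> : lift 0 0 = 1 :> 'I_2 by apply/val_inj.
have -> : lift 1 0 = 0 :> 'I_2 by apply/val_inj.
rewrite !(tnth_nth 0) /=.
ring.
Qed.

Lemma det_cols3 (K : comPzRingType) (p q d : 'cV[K]_3) :
  \det (cols [tuple p; q; d]) =
    p 0 0 * (q 1 0 * d 2 0 - d 1 0 * q 2 0)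
    - q 0 0 * (p 1 0 * d 2 0 - d 1 0 * p 2 0)
    + d 0 0 * (p 1 0 * q 2 0 - q 1 0 * p 2 0).
Proof. 
rewrite (expand_det_row _ 0) !big_ord_recl big_ord0 /cofactor /=.
rewrite !(expand_det_row _ 0) !big_ord_recl !big_ord0 /cofactor !det_mx11 !mxE.
rewrite !(tnth_nth 0) /=.
have -> : lift 0 (lift 0 0) = 2 :> 'I_3 by apply/val_inj.
have -> : lift 0 0 = 1 :> 'I_3 by apply/val_inj.
ring.
Qed.

(** With d a basis vector the determinant is, up to sign, a coordinate of the
    cross product of p and q. *)
Lemma det_cols3_parallel (K : comPzRingType) (p q : 'cV[K]_3) :
  (forall d, \det (cols [tuple p; q; d]) = 0) ->
  forall i j, p i 0 * q j 0 = p j 0 * q i 0.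
Proof.
move=> h.
have p01 : p 0 0 * q 1 0 = p 1 0 * q 0 0.
  have := h (delta_mx 2 0); rewrite det_cols3 !mxE /= => h01.
  by apply/subr0_eq; rewrite -[RHS]h01; ring.
have p02 : p 0 0 * q 2 0 = p 2 0 * q 0 0.
  have := h (delta_mx 1 0); rewrite det_cols3 !mxE /= => h02.
  by apply/subr0_eq; rewrite -[RHS]oppr0 -h02; ring.
have p12 : p 1 0 * q 2 0 = p 2 0 * q 1 0.
  have := h (delta_mx 0 0); rewrite det_cols3 !mxE /= => h12.
  by apply/subr0_eq; rewrite -[RHS]h12; ring.
have ord3 (i : 'I_3) : [\/ i = 0, i = 1 | i = 2].
  case: i => [[|[|[|//]]] lti];
    [apply: Or31 | apply: Or32 | apply: Or33]; exact/val_inj.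
by move=> i j; case: (ord3 i) => ->; case: (ord3 j) => ->.
Qed.

(** * Transposing maps that preserve the calibration *)

Definition preserves_sl (R : realType) n (Psi : 'M[R]_(n + n)) :=
  pullback Psi (@special_lagrangian R n) =1 @special_lagrangian R n.

(** A unit vector on which dx is 1 has no dy component, so v is the first basis
    vector, and the first row of Psi is the first coordinate form. *)
Lemma preserves_sl1_trmx (R : realType) (Psi : 'M[R]_(1 + 1))
    (v : 1.-tuple 'cV[R]_(1 + 1)) :
    preserves_sl Psi -> dot (tnth v 0) (tnth v 0) = 1 ->
    special_lagrangian v = 1 ->
  special_lagrangian (map_tuple (mulmx Psi^T) v) = 1.
Proof.
have slE (u : 1.-tuple 'cV[R]_(1 + 1)) :
    special_lagrangian u = tnth u 0 (lshift 1 0) 0.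
  by rewrite special_lagrangianE det_mx11 !mxE.
move=> hPsi; rewrite !slE tnth_map; move: (tnth v 0) => {v} w.
rewrite /dot big_split_ord !big_ord1 => /[swap] w1; rewrite w1 mulr1.
move=> /(canRL (addKr _)); rewrite addNr => /eqP.
rewrite mulf_eq0 orbb => /eqP w2.
rewrite mxE big_split_ord !big_ord1 w1 w2 /= mulr0 addr0 mulr1 mxE.
have := hPsi [tuple delta_mx (lshift 1 0) 0].
rewrite /pullback !slE !tnth_map !(tnth_nth 0) /= -colE.
by rewrite !mxE !eqxx [ord0]ord1.
Qed.

Section DimensionTwo.
Variable R : realType.

Let e : 'M[R]_2 := \matrix_(i, j) ((i < j)%:R - (j < i)%:R).
(* The Gram matrix of dx^1 /\ dx^2 - dy^1 /\ dy^2. *)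
Let G : 'M[R]_(2 + 2) := block_mx e 0 0 (- e).

Lemma special_lagrangian2E (v : 2.-tuple 'cV[R]_(2 + 2)) :
  special_lagrangian v = ((tnth v 0)^T *m G *m tnth v 1) 0 0.
Proof.
have vE : map_tuple (@cmx R 2 1) v = [tuple cmx (tnth v 0); cmx (tnth v 1)].
  apply/eq_from_tnth => i; rewrite tnth_map.
  by case: i => [[|[|//]] ?]; rewrite !(tnth_nth 0).
rewrite special_lagrangianE cmx_cols vE det_cols2 ![in LHS]mxE; simpc => /=.
rewrite -[in RHS](vsubmxK (tnth v 0)) -[in RHS](vsubmxK (tnth v 1)) tr_col_mx.
rewrite mul_row_block !mulmx0 addr0 add0r mul_row_col mxE mulmxN mulNmx.
do 3! rewrite ?[in RHS]mxE ?big_ord_recl ?big_ord0.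
have -> : lift ord0 ord0 = 1 :> 'I_2 by apply/val_inj.
have -> : ord0 = 0 :> 'I_2 by [].
rewrite /=; ring.
Qed.

(** Psi^T G Psi = G and G^2 = -1 exhibit - G Psi^T G as a left inverse of Psi;
    that it is also a right inverse gives Psi G Psi^T = G. *)
Lemma preserves_sl2_trmx (Psi : 'M[R]_(2 + 2)) :
  preserves_sl Psi -> preserves_sl Psi^T.
Proof.
move=> hPsi.
have GG : G *m G = - 1%:M.
  have ee : e *m e = - 1%:M.
    apply/matrixP => i j; rewrite !mxE !big_ord_recl big_ord0 !mxE.
    by case: i j => [[|[|//]] ?] [[|[|//]] ?]; rewrite -?val_eqE /=; ring.
  rewrite mulmx_block !(mulmx0, mul0mx, addr0, add0r) mulmxN mulNmx opprK ee.
  by rewrite scalar_mx_block opp_block_mx !oppr0.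
have PG : Psi^T *m G *m Psi = G.
  apply/matrixP => i j.
  have entry (A : 'M[R]_(2 + 2)) :
      A i j = ((delta_mx i 0)^T *m A *m delta_mx j 0 : 'M[R]_1) 0 0.
    by rewrite trmx_delta -rowE -colE !mxE.
  have := hPsi [tuple delta_mx i 0; delta_mx j 0].
  rewrite /pullback !special_lagrangian2E !tnth_map /= -entry => <-.
  by rewrite entry trmx_mul !mulmxA.
have GP : Psi *m G *m Psi^T = G.
  have : - (G *m Psi^T *m G) *m Psi = 1%:M.
    by rewrite mulNmx -!mulmxA [Psi^T *m _]mulmxA PG GG opprK.
  move/mulmx1C; rewrite mulmxN => /(congr1 (fun X => X *m G)).
  by rewrite mul1mx mulNmx -!mulmxA GG !mulmxN mulmx1 opprK.
move=> v; rewrite /pullback !special_lagrangian2E !tnth_map trmx_mul trmxK.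
by rewrite !mulmxA -[_ *m Psi *m G]mulmxA -[_ *m (Psi *m G) *m _]mulmxA GP.
Qed.

End DimensionTwo.

Section DimensionThree.
Variables (R : realType) (Psi : 'M[R]_(3 + 3)).
Hypotheses (uPsi : Psi \in unitmx) (hPsi : preserves_sl Psi).

Let toC p q : 'M[R]_(p, q) -> 'M[R[i]]_(p, q) := map_mx (real_complex R).
Let M := cmx (lsubmx Psi).
Let N := cmx (rsubmx Psi).
(* The action of Psi on C^3, as a function of real and imaginary parts. *)
Let f p (P Q : 'M[R]_(3, p)) := cmx (Psi *m col_mx P Q).

Lemma Re_det_preserves_sl3 (V : 'M[R]_(3 + 3, 3)) :
  complex.Re (\det (cmx (Psi *m V))) = complex.Re (\det (cmx V)).
Proof.
have -> : V = cols [tuple col i V | i < 3].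
  by apply/matrixP => i j; rewrite !mxE tnth_mktuple mxE.
by rewrite mulmx_cols -!special_lagrangianE; apply: hPsi.
Qed.

Lemma Re_det_lsubmx_sl3 : complex.Re (\det M) = 1.
Proof.
have := Re_det_preserves_sl3 (col_mx 1%:M 0).
rewrite cmx_mull cmx_col_mx !map_mx1 !map_mx0 mulmx0 scaler0 !addr0 mulmx1.
by rewrite det1.
Qed.

Let M_unit : M \in unitmx.
Proof.
rewrite unitmxE unitfE; apply: contra_eq_neq Re_det_lsubmx_sl3 => ->.
by rewrite eq_sym oner_eq0.
Qed.

(* M, which gives the action of Psi on real vectors, is invertible since its
   determinant has real part 1.  Composing Psi with its inverse gives the map
   x + i y |-> x + S y, which fixes every real vector. *)
Let S := invmx M *m N.

(** The vectors u = x + i y and i u = - y + i x are complex dependent, so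
    Re Omega (u, i u, z) = 0 for all z; hence Re Omega (Psi u, Psi (i u), c) = 0
    for all c, because Psi is onto.  Replacing c by i c removes the Re. *)
Lemma det_image_line_sl3 (x y : 'cV[R]_3) (c : 'cV[R[i]]_3) :
  \det (cols [tuple f x y; f (- y) x; c]) = 0.
Proof.
have Re0 d : complex.Re (\det (cols [tuple f x y; f (- y) x; d])) = 0.
  pose z : 'cV[R]_(3 + 3) :=
    invmx Psi *m col_mx (map_mx (@complex.Re R) d) (map_mx (@complex.Im R) d).
  have := Re_det_preserves_sl3 (cols [tuple col_mx x y; col_mx (- y) x; z]).
  rewrite mulmx_cols !cmx_cols.
  have -> : map_tuple (@cmx R 3 1) (map_tuple (mulmx Psi)
      [tuple col_mx x y; col_mx (- y) x; z]) = [tuple f x y; f (- y) x; d].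
    apply/val_inj; rewrite /= /z mulKVmx //; congr [:: _; _; _].
    apply/matrixP => i j; rewrite mxE col_mxEu col_mxEd !mxE.
    by case: (d i j).
  have -> : map_tuple (@cmx R 3 1) [tuple col_mx x y; col_mx (- y) x; z] =
      [tuple cmx (col_mx x y); 'i *: cmx (col_mx x y); cmx z].
    apply/val_inj; rewrite /=; congr [:: _; _; _].
    rewrite !cmx_col_mx scalerDr scalerA -expr2 sqr_i scaleN1r addrC.
    by rewrite map_mxN.
  move=> ->; rewrite det_cols3 ![('i *: cmx (col_mx x y)) _ _]mxE.
  rewrite [X in complex.Re X](_ : _ = 0) //; ring.
(* Re (i D) = - Im D *)
have Im0 := Re0 ('i *: c).
have := Re0 c; set D := \det _ => ReD.
have : complex.Re ('i * D) = 0.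
  rewrite -Im0 /D !det_cols3 ![('i *: c) _ _]mxE.
  by congr complex.Re; ring.
case: D ReD => a b /= ->; rewrite mul0r mul1r sub0r => /(canRL opprK) ->.
by rewrite oppr0.
Qed.

(** The map x + i y |-> x + S y sends complex lines into complex lines: p and q
    are the images of x + i y and of i (x + i y). *)
Lemma parallel_sl3 (x y : 'cV[R]_3) i j :
  let p := toC x + S *m toC y in let q := S *m toC x - toC y in
  p i 0 * q j 0 = p j 0 * q i 0.
Proof.
move=> p q; apply: det_cols3_parallel => d.
have := det_image_line_sl3 x y (M *m d).
have -> : [tuple f x y; f (- y) x; M *m d] =
    map_tuple (mulmx M) [tuple p; q; d].
  apply/val_inj => /=; congr [:: _; _; _].
    by rewrite /f cmx_mull mulmxDr /S !mulmxA mulmxV ?mul1mx.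
  rewrite /f cmx_mull mulmxBr /S !mulmxA mulmxV ?mul1mx //.
  by rewrite map_mxN mulmxN addrC.
rewrite -mulmx_cols det_mulmx => /eqP; rewrite mulf_eq0.
by move: M_unit; rewrite unitmxE unitfE => /negPf-> /eqP.
Qed.

(** Psi is complex linear or antilinear: l = i or l = -i.  By [parallel_sl3] for
    the basis vectors, S is diagonal; for the vector (1, 1, 1), its diagonal
    entries agree; for e_0 + i e_1, with image e_0 + l e_1, their common value l
    has square -1 since multiplication by i turns it into - e_1 + i e_0, with
    image l e_0 - e_1. *)
Lemma rsubmx_sl3 : exists2 l : R[i], l ^+ 2 = -1 & N = l *: M.
Proof.
have NS : N = M *m S by rewrite /S mulKVmx.
move: S NS parallel_sl3 => T NS par.
have toCd k : toC (delta_mx k 0) = delta_mx k 0 :> 'cV_3.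
  exact: map_delta_mx.
have toC0 : toC 0 = 0 :> 'cV[R[i]]_3 by exact: map_mx0.
have Tdiag i j : T j i = (j == i)%:R * T i i.
  have := par (delta_mx i 0) 0 i j => /=.
  by rewrite toC0 toCd mulmx0 addr0 subr0 -colE !mxE !eqxx !andbT mul1r.
have Tconst j : T j j = T 0 0.
  have := par (const_mx 1) 0 0 j => /=.
  rewrite toC0 mulmx0 addr0 subr0.
  have Tx k : (T *m toC (const_mx 1)) k 0 = T k k.
    rewrite mxE (bigD1 k) //= big1 => [|l lk].
      by rewrite !mxE mulr1 addr0.
    by rewrite Tdiag eq_sym (negPf lk) mul0r mul0r.
  by rewrite !Tx !mxE !mul1r.
have TE : T = (T 0 0)%:M.
  by apply/matrixP => i j; rewrite Tdiag Tconst [in RHS]mxE mulr_natl.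
exists (T 0 0).
  have := par (delta_mx 0 0) (delta_mx 1 0) 0 1 => /=.
  rewrite !toCd TE !mul_scalar_mx !mxE /=.
  rewrite !(mulr0, mulr1, addr0, add0r, subr0, sub0r, mul1r) => ->.
  by rewrite expr2.
by rewrite -mul_mx_scalar -TE.
Qed.

End DimensionThree.

(** * Ellipsoids inside cylinders *)

Section Squeezing.
Variables (R : realType) (m : nat).
Implicit Types (u v x y : 'cV[R]_m) (L : {vspace 'cV[R]_m}).

Lemma dotE u v : dot u v = (u^T *m v) 0 0.
Proof. by rewrite mxE; apply: eq_bigr => i _; rewrite mxE. Qed.

Lemma dotC u v : dot u v = dot v u.
Proof. by apply: eq_bigr => i _; rewrite mulrC. Qed.

Lemma dot_ge0 u : 0 <= dot u u.
Proof. by apply: sumr_ge0 => i _; rewrite -expr2 sqr_ge0. Qed.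

Lemma sqr_enorm u : enorm u ^+ 2 = dot u u.
Proof. by rewrite sqr_sqrtr ?dot_ge0. Qed.

Lemma dot_proj L v y : v \in L -> dot v (proj L y) = dot v y.
Proof.
move=> vL; apply/eqP; rewrite eq_sym -subr_eq0 -linearBr /= dotC.
by have /mem_orthovP/(_ v vL) -> := proj_orthov L y.
Qed.

(** The Cauchy-Schwarz inequality for v and the projection p of y to L, from
    the nonnegative square norm of p - (v . p) v. *)
Lemma sqr_dot_le_cylinder L (r : R) v y :
  v \in L -> dot v v = 1 -> cylinder L r y -> dot v y ^+ 2 <= r ^+ 2.
Proof.
move=> vL v1; rewrite /cylinder /= sqr_enorm; apply: le_trans.
rewrite -(dot_proj y vL); set p := proj L y.
have := dot_ge0 (p - dot v p *: v).
rewrite linearBl !linearBr /= !linearZl_LR !linearZr_LR /= v1 (dotC p v).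
by rewrite expr2; lra.
Qed.

(** The translation part does no harm: if both points Psi x + x0 and
    - Psi x + x0 lie in a slab symmetric about 0, then so does Psi x.  The point
    of the ball that Psi moves farthest in the direction v is the multiple of
    Psi^T v on its boundary. *)
Lemma affine_squeeze (Psi : 'M[R]_m) x0 (r rho : R) L v :
    0 < r -> affine Psi x0 @` eball r `<=` cylinder L rho ->
    v \in L -> dot v v = 1 ->
  r ^+ 2 * dot (Psi^T *m v) (Psi^T *m v) <= rho ^+ 2.
Proof.
move=> r_gt0 sub vL v1; set w := Psi^T *m v.
have [->|w_neq0] := eqVneq w 0.
  by rewrite linear0l mulr0 sqr_ge0.
have ww_gt0 := dot_gt0 w_neq0.
have bound x : dot x x <= r ^+ 2 -> dot w x ^+ 2 <= rho ^+ 2.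
  have adj y : dot v (affine Psi x0 y) = dot w y + dot v x0.
    rewrite /affine linearDr /= /w (dotE (Psi^T *m v)) trmx_mul trmxK -mulmxA.
    by rewrite -dotE.
  have in_ball y : dot y y <= r ^+ 2 -> (dot w y + dot v x0) ^+ 2 <= rho ^+ 2.
    move=> yr; rewrite -adj; apply: (sqr_dot_le_cylinder vL v1); apply: sub.
    exists y => //=; rewrite /eball /= -(ler_pXn2r (_ : (0 < 2)%N)) ?nnegrE //.
    - by rewrite sqr_enorm.
    - exact: sqrtr_ge0.
    - exact: ltW.
  move=> xr; have pos := in_ball x xr.
  have neg : (- dot w x + dot v x0) ^+ 2 <= rho ^+ 2.
    by rewrite -linearNr; apply: in_ball; rewrite linearNl linearNr opprK.
  by have := sqr_ge0 (dot v x0); move: pos neg; rewrite !expr2; nra.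
have := bound ((r / enorm w) *: w).
rewrite !linearZl_LR !linearZr_LR /= -sqr_enorm.
have e_neq0 : enorm w != 0.
  by rewrite -sqrf_eq0 sqr_enorm gt_eqF.
rewrite (_ : r / enorm w * (r / enorm w * _) = r ^+ 2); last by field.
move/(_ (lexx _)); congr (_ <= _); field.
exact: e_neq0.
Qed.

End Squeezing.

(** * Lower bound in terms of the calibration *)

Lemma exists_col_ge1 (R : realType) n (V : 'M[R]_(n + n, n)) :
    (0 < n)%N -> 1 <= `|\det (cmx V)| ->
  exists j, 1 <= dot (col j V) (col j V).
Proof.
move=> n_gt0 detV; apply/existsP; apply: contraTT detV => /existsPn small.
rewrite -real_ltNge ?realE ?ler01 ?normr_ge0 //.
rewrite -(@expr_lt1 _ 2) ?normr_ge0 // -det_tr.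
apply: le_lt_trans (hadamard _) _.
have -> : \prod_i \sum_j `|(cmx V)^T i j| ^+ 2 =
    (\prod_i dot (col i V) (col i V))%:C.
  rewrite rmorph_prod; apply: eq_bigr => i _.
  by rewrite /= -sum_normr_cmx; apply: eq_bigr => j _; rewrite mxE.
rewrite ltcR; have small' i : 0 <= dot (col i V) (col i V) < 1.
  by rewrite dot_ge0 ltNge small.
case: n n_gt0 V small small' => // n _ V _ small'.
rewrite big_ord_recl -[ltRHS]mulr1.
have /andP[a0 a1] := small' ord0.
apply: le_lt_trans (ler_wpM2l a0 (_ : _ <= 1)) _; last by rewrite !mulr1.
by apply: prodr_ile1 => i _; have /andP[-> /ltW] := small' (lift ord0 i).
Qed.

Lemma norm_det_preserves_sl (R : realType) n (Psi : 'M[R]_(n + n))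
    (v : n.-tuple 'cV[R]_(n + n)) :
    n \in [:: 1; 2; 3]%N -> Psi \in unitmx -> preserves_sl Psi ->
    (forall j, dot (tnth v j) (tnth v j) = 1) -> special_lagrangian v = 1 ->
  1 <= `|\det (cmx (Psi^T *m cols v))|.
Proof.
have ge1 k (Z : 'M[R[i]]_k) : complex.Re (\det Z) = 1 -> 1 <= `|\det Z|.
  by move=> Z1; apply: le_trans (normc_ge_Re _); rewrite Z1 normr1.
rewrite !inE => /or3P[] /eqP n_eq; subst n => uPsi hPsi v1 slv.
- apply: ge1; rewrite mulmx_cols -special_lagrangianE.
  exact: preserves_sl1_trmx.
- apply: ge1; rewrite mulmx_cols -special_lagrangianE.
  by have := preserves_sl2_trmx hPsi v; rewrite /pullback => ->.
- have [l l2 NM] := rsubmx_sl3 uPsi hPsi.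
  rewrite (norm_det_trmx _ l2 NM) mulr_ege1 ?ge1 //.
    exact: Re_det_lsubmx_sl3.
  by rewrite -special_lagrangianE.
Qed.

Theorem mainTheorem9 (R : realType) (n : nat) (hn : n \in [:: 1; 2; 3]%N)
    (Psi : 'M[R]_(n + n)) (x0 : 'cV[R]_(n + n)) (hPsi : Psi \in unitmx)
    (hpres : pullback Psi (@special_lagrangian R n) =1 @special_lagrangian R n)
    (r rho : R) (hr : 0 < r) (hrho : 0 < rho)
    (L : orientedSubspace 'cV[R]_(n + n) n)
    (hL : calibrated (@special_lagrangian R n) L)
    (hball : affine Psi x0 @` eball r `<=` cylinder L rho) :
  r <= rho.
Proof.
case: hL => v [Lv v_on slv].
have n_gt0 : (0 < n)%N by move: hn; rewrite !inE => /or3P[] /eqP ->.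
have vL j : tnth v j \in os_space L.
  case: L Lv {hball} => Ls ori ex bas comp /= /bas.
  by move/basis_mem; apply; exact: mem_tnth.
have v1 j : dot (tnth v j) (tnth v j) = 1.
  by case/andP: v_on => /allP/(_ _ (mem_tnth j v))/eqP.
have [j] := exists_col_ge1 n_gt0
  (norm_det_preserves_sl hn hPsi hpres v1 slv).
rewrite mulmx_cols (_ : col j _ = Psi^T *m tnth v j); last first.
  by apply/matrixP => i k; rewrite !mxE tnth_map mxE ord1.
move=> w_ge1.
rewrite -(ler_pXn2r (_ : (0 < 2)%N)) ?nnegrE ?(ltW hr, ltW hrho) //.
apply: le_trans (affine_squeeze hr hball (vL j) (v1 j)).
by rewrite ler_peMr // sqr_ge0.
Qed.
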